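(* For all $u,v\in S_n$, $$\mathcal T_{u,v}=\bigsqcup_{[x,y]\subseteq[u,v]}\mathcal T_{x,y}^\circ,$$ where the disjoint union is over all subintervals $[x,y]$ of $[u,v]$ in the tilted Bruhat order $D_u$, i.e. over all pairs $(x,y)\in S_n\times S_n$ with $x\leq_u y\leq_u v$.
   Context: $[n]=\{1,\dots,n\}$. $\mathrm{Fl}_n$ is the variety of complete flags $F_\bullet=(0=F_0\subsetneq F_1\subsetneq\cdots\subsetneq F_n=\mathbb C^n)$. For $w\in S_n$, $w[k]:=\{w(1),\dots,w(k)\}$. For $S\subset[n]$, $\mathrm{Proj}_S:\mathbb C^n\to\mathbb C^{|S|}$ is the projection onto the coordinates indexed by $S$. Tilted Bruhat order: with $\ell(w)$ the number of inversions and $t_{ij}=(i\ j)$, the quantum Bruhat graph is the directed graph on $S_n$ with edges $w\to wt_{ij}$ ($i<j$) whenever $\ell(wt_{ij})=\ell(w)+1$ or $\ell(wt_{ij})=\ell(w)+1-2(j-i)$; $\ell(u,v)$ is the length of a shortest directed path from $u$ to $v$. The tilted Bruhat order $D_u$ on $S_n$ is the partial order with $w\leq_u v$ iff $\ell(u,w)+\ell(w,v)=\ell(u,v)$. For $x\leq_u y$, the interval $[x,y]=\{z: x\leq_u z\leq_u y\}$ (it does not depend on $u$ as long as $x\leq_u y$); in particular $[u,v]=\{z:u\leq_u z\leq_u v\}$. Shifted orders: for $r\in[n]$, $\leq_r$ is the linear order $r<_r r+1<_r\cdots<_r n<_r1<_r\cdots<_r r-1$ on $[n]$; for $A=\{a_1<_r\cdots<_r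 a_k\}$, $B=\{b_1<_r\cdots<_r b_k\}$, $A\leq_r B$ iff $a_i\leq_r b_i$ for all $i$. For $\mathbf a=(a_1,\dots,a_{n-1})\in[n]^{n-1}$ write $u\leq_{\mathbf a}v$ if $u[k]\leq_{a_k}v[k]$ for all $k\in[n-1]$. Cyclic intervals: $[a,b]_c=\{a,\dots,b\}$ if $1\le a\leq b\le n$; $[a,b]_c=\{a,\dots,n\}\cup\{1,\dots,b\}$ if $a>b\ge1$; $[a,0]_c=\{a,\dots,n\}$. Tilted Richardson varieties: for $u\leq_{\mathbf a}v$, $\mathcal T_{u,v,\mathbf a}$ is the set of $F_\bullet\in\mathrm{Fl}_n$ such that for all $i\in[n-1]$, $j\in[n]$: $\dim(\mathrm{Proj}_{[a_i,j]_c}(F_i))\leq\#(u[i]\cap[a_i,j]_c)$ and $\dim(\mathrm{Proj}_{[j,a_i-1]_c}(F_i))\leq\#(v[i]\cap[j,a_i-1]_c)$; $\mathcal T^\circ_{u,v,\mathbf a}$ is defined by the same conditions with $=$ in place of $\leq$. For every $u,v$ there is $\mathbf a$ with $u\leq_{\mathbf a}v$, and these sets do not depend on the choice of such $\mathbf a$; they are denoted $\mathcal T_{u,v}$ and $\mathcal T_{u,v}^\circ$. *)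

(* Defs.v *)
From HB Require Import structures.
From mathcomp Require Import all_boot all_order all_algebra all_fingroup.
From mathcomp Require Import complex.
From mathcomp Require Import classical_sets reals.

Set Implicit Arguments.
Unset Strict Implicit.
Unset Printing Implicit Defensive.

Import GRing.Theory Num.Theory.
Local Open Scope ring_scope.

(* Throughout, x : 'I_n stands for the element x.+1 of [n] = {1, ..., n}. *)

Section Permutations.

Variable n : nat.
Implicit Types (u v w : 'S_n) (A B : {set 'I_n}).

Definition inv_length w : nat :=
  #|[set p : 'I_n * 'I_n | (p.1 < p.2)%N && (w p.2 < w p.1)%N]%SET|.

(* Products of permutations are composed from left to right in perm.v, so that
   w \o tperm i j is tperm i j * w. The quantum case
   l(w t_ij) = l(w) + 1 - 2 (j - i) is stated without subtracting from l(w). *)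
Definition qb_edge : rel 'S_n := fun w w' =>
  [exists i : 'I_n, exists j : 'I_n,
    [&& (i < j)%N, w' == (tperm i j * w)%g &
        (inv_length w' == inv_length w + 1)%N
        || (inv_length w' + 2 * (j - i) == inv_length w + 1)%N]].

(* The least k such that there is a path with k edges from u to v. A shortest
   path has fewer than #|'S_n| edges, and there is one for all u and v since
   w -> w t_(i, i+1) is always an edge. *)
Definition qb_dist u v : nat :=
  find (fun k => [exists p : k.-tuple 'S_n,
                    path qb_edge u p && (last u p == v)])
       (iota 0 #|{: 'S_n}|).

Definition tilted_le u w v : bool :=
  (qb_dist u w + qb_dist w v == qb_dist u v)%N.

Definition init_set w (k : nat) : {set 'I_n} :=
  (w @: [set i : 'I_n | (i < k)%N])%SET.

Definition shift_le (r : 'I_n) : rel 'I_n := fun x y =>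
  ((x + (n - r)) %% n <= (y + (n - r)) %% n)%N.

(* all2 also requires #|A| = #|B|. *)
Definition shift_set_le (r : 'I_n) A B : bool :=
  all2 (shift_le r) (sort (shift_le r) (enum A)) (sort (shift_le r) (enum B)).

(* A vector (a_1, ..., a_(n-1)) in [n]^(n-1) is indexed by 'I_n.-1, its value
   at k being a_(k+1). *)
Definition vec_le (a : 'I_n.-1 -> 'I_n) u v : bool :=
  [forall k : 'I_n.-1, shift_set_le (a k) (init_set u k.+1) (init_set v k.+1)].

(* The endpoints are numbered from 1, as in [n]; for c = 0 < b this is
   {b, ..., n}. *)
Definition cyc_int (b c : nat) : {set 'I_n} :=
  [set x : 'I_n | if (b <= c)%N then (b <= x.+1 <= c)%N
                  else (b <= x.+1)%N || (x.+1 <= c)%N]%SET.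

End Permutations.

Section Flags.

Variables (R : realType) (n : nat).

Record flag := Flag {
  flag_space :> 'I_n.+1 -> {vspace 'rV[R[i]]_n};
  flag_first : flag_space ord0 = 0%VS;
  flag_last : flag_space ord_max = fullv;
  flag_proper : forall i j : 'I_n.+1, (i < j)%N ->
    (flag_space i <= flag_space j)%VS /\ flag_space i <> flag_space j
}.

Definition coord_proj (S : {set 'I_n}) : 'Hom('rV[R[i]]_n, 'rV[R[i]]_#|S|) :=
  linfun (colsub (fun j : 'I_#|S| => enum_val j)).

Definition proj_dim (F : flag) (k : nat) (S : {set 'I_n}) : nat :=
  \dim (coord_proj S @: F (inord k))%VS.

Implicit Types (u v : 'S_n) (a : 'I_n.-1 -> 'I_n).

(* In these two definitions a_(i+1) is (a i).+1 when numbered from 1, so that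
   cyc_int j.+1 (a i) is [j+1, a_(i+1) - 1]_c. *)
Definition tilted_richardson_vec u v a : set flag :=
  [set F | forall (i : 'I_n.-1) (j : 'I_n),
    (proj_dim F i.+1 (cyc_int n (a i).+1 j.+1)
       <= #|init_set u i.+1 :&: cyc_int n (a i).+1 j.+1|)%N /\
    (proj_dim F i.+1 (cyc_int n j.+1 (a i))
       <= #|init_set v i.+1 :&: cyc_int n j.+1 (a i)|)%N]%classic.

Definition open_tilted_richardson_vec u v a : set flag :=
  [set F | forall (i : 'I_n.-1) (j : 'I_n),
    proj_dim F i.+1 (cyc_int n (a i).+1 j.+1)
      = #|init_set u i.+1 :&: cyc_int n (a i).+1 j.+1| /\
    proj_dim F i.+1 (cyc_int n j.+1 (a i))
      = #|init_set v i.+1 :&: cyc_int n j.+1 (a i)|]%classic.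

(* Such an a exists for all u and v, and the sets above do not depend on it. *)
Definition tilted_richardson u v : set flag :=
  [set F | exists2 a, vec_le a u v & tilted_richardson_vec u v a F]%classic.

Definition open_tilted_richardson u v : set flag :=
  [set F | exists2 a, vec_le a u v & open_tilted_richardson_vec u v a F]%classic.

End Flags.

Arguments tilted_richardson R {n} u v.
Arguments open_tilted_richardson R {n} u v.

(* Main.v *)
Require Import Defs.
From mathcomp Require Import all_boot all_order all_algebra all_fingroup.
From mathcomp Require Import complex.
From mathcomp Require Import reals.
From mathcomp Require Import zify.

(** Write x_k for the set of the first k values of x, and F_k for the k-th
    space of a flag F.

    For sets A and B of equal size, consider the excess of B over A among the
    elements smaller than c, as a function of the cut c. Then A <=_r B holds iff
    the cut r maximises this excess ([shift_set_leE]); call r a best cut and let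
    [gap A B] be the maximum. The gap satisfies the triangle inequality, and
    gap A B + gap B C = gap A C iff one, equivalently each, best cut of (A, C)
    is a best cut of both (A, B) and (B, C) ([best_cut_between]).

    Combinatorics of the order. Every edge u -> w of the quantum Bruhat graph
    satisfies l(w) + 2 sum_k gap (u_k, w_k) = l(u) + 1. The triangle inequality
    thus bounds the distance from below:
    l(u, v) >= l(v) - l(u) + 2 sum_k gap (u_k, v_k). Equality holds, since from
    each u <> v some edge leads to a w through which all gaps add up
    ([qb_edge_between]). Hence w lies on a geodesic from u to v iff all the
    gaps add up, that is, iff u <=_a w <=_a v for any a with u <=_a v
    ([tilted_le_vec_le]). So the condition that x <=_u y and y <=_u v becomes
    u <=_a x <=_a y <=_a v for one vector a fixed in advance
    ([tilted_interval]).

    Geometry. For a subspace U the dimensions of the coordinate projections form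
    a matroid rank function. Reading the coordinates in the cyclic order that
    starts at r, forwards or backwards, the positions where the rank jumps form
    two sets X and Y; the conditions that define the closed variety say that
    A <=_r X and Y <=_r B, those of the open one that A = X and B = Y. If b is
    also a best cut of (X, Y), the two arcs between r and b have ranks adding up
    to dim U, so U is a direct sum along these arcs, and reading from b instead
    of r yields the same X and Y ([jumps_change_cut]). So both varieties can be
    tested at any vector of best cuts.

    Given a flag in the closed variety of (u, v), let X_k and Y_k be its jump
    sets at level k. The pairs (u_k, v_k) and (u_(k+1), v_(k+1)) always have a
    common best cut ([common_best_cut]), and for a fixed cut the jump sets of
    F_k are contained in those of F_(k+1). So X_k and Y_k are the initial sets
    of two permutations x and y ([flag_position]), u <=_a x <=_a y <=_a v, and
    the flag is in the open variety of (x, y). Conversely, and for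
    disjointness, an open variety with u <=_a x <=_a y <=_a v may be tested at
    a itself, where x and y are read off from the flag. *)

Set Implicit Arguments.
Unset Strict Implicit.
Unset Printing Implicit Defensive.
Import GRing.Theory.

(** * Cuts and shifted orders *)

Section Cuts.
Variable n : nat.
Implicit Types (A B C : {set 'I_n}).

Definition cnt A (c : nat) := #|[set x in A | (x < c)%N]|.

Definition gap A B := \max_(c < n) (cnt B c - cnt A c).

(** The shifted order that starts at c, see [shift_set_leE]. Only the cuts
    0, ..., n - 1 are used: for sets of equal size the cut n has the same
    excess, zero, as the cut 0. *)
Definition best_cut A B (c : 'I_n) := cnt B c == cnt A c + gap A B.

Lemma cnt_le_gap A B (c : 'I_n) : cnt B c <= cnt A c + gap A B.
Proof. by rewrite -leq_subLR; apply: (leq_bigmax_cond c). Qed.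

Lemma cnt0 A : cnt A 0 = 0.
Proof. by apply: eq_card0 => x; rewrite inE ltn0 andbF. Qed.

Lemma cnt_full A c : n <= c -> cnt A c = #|A|.
Proof.
move=> nc; apply: eq_card => x; rewrite inE.
by rewrite (leq_trans (ltn_ord x) nc) andbT.
Qed.

Lemma best_cutP A B (c : 'I_n) :
  reflect (forall d : 'I_n, cnt B d + cnt A c <= cnt A d + cnt B c)
          (best_cut A B c).
Proof.
apply: (iffP eqP) => [Ec d|H]; first by have := cnt_le_gap A B d; lia.
apply/eqP; rewrite eqn_leq cnt_le_gap /= -leq_subRL; last first.
  have n0 : 0 < n by apply: leq_ltn_trans (ltn_ord c).
  by have := H (Ordinal n0); rewrite /= !cnt0; lia.
by apply/bigmax_leqP => d _; have := H d; lia.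
Qed.

Lemma best_cut_exists A B : 0 < n -> exists c, best_cut A B c.
Proof.
move=> n0; have [|c Ec] := @eq_bigmax 'I_n (fun c => cnt B c - cnt A c).
  by rewrite card_ord.
rewrite /best_cut; case: (posnP (gap A B)) => [->|].
  by exists (Ordinal n0); rewrite /= !cnt0.
by rewrite /gap Ec => ?; exists c; apply/eqP; lia.
Qed.

Lemma gap_triangle A B C : gap A C <= gap A B + gap B C.
Proof.
apply/bigmax_leqP => c _.
by have := cnt_le_gap A B c; have := cnt_le_gap B C c; lia.
Qed.

Lemma gapxx A : gap A A = 0.
Proof. by apply/eqP; rewrite -leqn0; apply/bigmax_leqP => c _; lia. Qed.

(** At a best cut of (A, C) the excess equals the sum of the two excesses, each
    at most its gap. The right-hand side does not mention the cut: this makes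
    the orders at different cuts comparable. *)
Lemma best_cut_between A B C (c : 'I_n) : best_cut A C c ->
  best_cut A B c && best_cut B C c = (gap A B + gap B C == gap A C).
Proof.
move=> /eqP EAC; have := cnt_le_gap A B c; have := cnt_le_gap B C c.
by rewrite /best_cut; lia.
Qed.

Lemma best_cut_trans A B C (c : 'I_n) :
  best_cut A B c -> best_cut B C c -> best_cut A C c.
Proof.
move=> /best_cutP AB /best_cutP BC; apply/best_cutP => d.
by have := AB d; have := BC d; lia.
Qed.

Definition shift_rank (r x : 'I_n) : nat := (x + (n - r)) %% n.

Lemma shift_rankE r x :
  shift_rank r x = if (r <= x)%N then x - r else x + n - r.
Proof.
rewrite /shift_rank; have := ltn_ord x; have := ltn_ord r.
case: (leqP r x) => rx rn xn.
  have -> : x + (n - r) = (x - r) + n by lia.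
  by rewrite modnDr modn_small //; lia.
by rewrite modn_small; lia.
Qed.

Lemma shift_rank_lt r x : shift_rank r x < n.
Proof. by rewrite ltn_mod; apply: leq_ltn_trans (ltn_ord x). Qed.

Lemma shift_rank_inj r : injective (shift_rank r).
Proof.
move=> x y E; apply: val_inj; move: E; rewrite !shift_rankE /=.
by case: (leqP r x); case: (leqP r y);
   have := ltn_ord x; have := ltn_ord y; have := ltn_ord r; lia.
Qed.

Definition below (f : 'I_n -> nat) (m : nat) : {set 'I_n} := [set x | f x < m].

(** The elements with large rank for the order that starts at r form the other
    kind of cyclic interval; reversing the rank turns them into initial
    segments, so that one theory of jumps serves both kinds. *)
Definition rev_rank (r x : 'I_n) : nat := n.-1 - shift_rank r x.

Local Notation seg r := (below (shift_rank r)).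
Local Notation coseg r := (below (rev_rank r)).

Lemma below0 f : below f 0 = set0.
Proof. by apply/setP=> x; rewrite !inE ltn0. Qed.

Lemma belowS f x : injective f -> below f (f x).+1 = x |: below f (f x).
Proof.
move=> f_inj; apply/setP=> y; rewrite !inE ltnS leq_eqVlt; congr (_ || _).
by apply/eqP/eqP => [/f_inj|->].
Qed.

Lemma below_skip f m : (forall x, f x != m) -> below f m.+1 = below f m.
Proof.
by move=> fm; apply/setP=> x; rewrite !inE ltnS leq_eqVlt (negPf (fm x)).
Qed.

Lemma rank_hit (f : 'I_n -> nat) m :
  (exists x : 'I_n, f x = m) \/ (forall x, f x != m).
Proof.
have [/existsP[x /eqP xm]|/existsPn fm] := boolP [exists x, f x == m].
  by left; exists x.
by right.
Qed.

Lemma below_ind f (Q : {set 'I_n} -> Prop) :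
  Q set0 -> (forall x, Q (below f (f x).+1)) -> forall m, Q (below f m).
Proof.
move=> Q0 QS; elim=> [|m IHm]; first by rewrite below0.
by have [[x <-]|/below_skip->] := rank_hit f m.
Qed.

Lemma seg_full r m : n <= m -> seg r m = setT.
Proof.
by move=> nm; apply/setP=> x; rewrite !inE (leq_trans (shift_rank_lt r x)).
Qed.

(** The segment lies between the cuts r and r + m, and may wrap around. *)
Lemma card_setI_seg A r m : m <= n ->
  #|A :&: seg r m| + cnt A r =
    if r + m <= n then cnt A (r + m) else cnt A (r + m - n) + #|A|.
Proof.
move=> mn; have rn := ltn_ord r; case: leqP => rm.
  rewrite /cnt -cardsUI -[RHS]addn0; congr (_ + _).
    apply: eq_card => x; rewrite !inE shift_rankE.
    by case: (x \in A) => //=; have := ltn_ord x; case: (leqP r x); lia.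
  apply: eq_card0 => x; rewrite !inE shift_rankE; case: (x \in A) => //=.
  by have := ltn_ord x; case: (leqP r x); lia.
rewrite -[in RHS](cardsID [set x : 'I_n | x < r] A) /cnt addnA addnAC.
have -> : A :&: [set x : 'I_n | x < r] = [set x in A | x < r].
  by apply/setP=> x; rewrite !inE.
congr (_ + _); rewrite -cardsUI -[LHS]addn0; congr (_ + _); last first.
  by symmetry; apply: eq_card0 => x; rewrite !inE; case: (x \in A); lia.
apply: eq_card => x; rewrite !inE shift_rankE.
case: (x \in A) => /=; last by rewrite andbF.
by have := ltn_ord x; case: (leqP r x); lia.
Qed.

Lemma best_cut_segP A B r : #|A| = #|B| ->
  reflect (forall m, #|B :&: seg r m| <= #|A :&: seg r m|) (best_cut A B r).
Proof.
move=> AB; have rn := ltn_ord r.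
have cA := card_setI_seg A r; have cB := card_setI_seg B r.
rewrite -AB in cB.
apply: (iffP (best_cutP _ _ _)) => H m.
  have [mn|nm] := leqP m n; last by rewrite seg_full ?setIT ?AB //; lia.
  have {cA} := cA m mn; have {cB} := cB m mn.
  case: (leqP (r + m) n) => rm; last first.
    have lt : r + m - n < n by lia.
    by have := H (Ordinal lt) => /=; lia.
  case: (ltnP (r + m) n) => lt; first by have := H (Ordinal lt) => /=; lia.
  have n0 : 0 < n by lia.
  by have := H (Ordinal n0); rewrite /= !cnt0 !(@cnt_full _ (r + m)) //; lia.
have mn := ltn_ord m; have [rm|mr] := leqP r m.
  have le : m - r <= n by lia.
  have := H (m - r); have := cA _ le; have := cB _ le.
  by rewrite subnKC // ltnW //; lia.
have le : m + n - r <= n by lia.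
have := H (m + n - r); have := cA _ le; have := cB _ le.
have -> : r + (m + n - r) = m + n by lia.
rewrite addnK; case: leqP => [mn0|_]; last by lia.
have -> : (m : nat) = 0 by lia.
by rewrite !cnt0 add0n !(@cnt_full _ n) // AB; lia.
Qed.

Lemma rev_rank_inj r : injective (rev_rank r).
Proof.
move=> x y; rewrite /rev_rank => E; apply: (@shift_rank_inj r).
by have := shift_rank_lt r x; have := shift_rank_lt r y; lia.
Qed.

Lemma coseg_seg r m : m <= n -> coseg r m = ~: seg r (n - m).
Proof.
move=> mn; apply/setP=> x; rewrite !inE /rev_rank.
by have := shift_rank_lt r x; lia.
Qed.

Lemma coseg_full r m : n <= m -> coseg r m = setT.
Proof.
move=> nm; apply/setP=> x; rewrite !inE /rev_rank.
by have := ltn_ord x; lia.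
Qed.

Lemma best_cut_cosegP A B r : #|A| = #|B| ->
  reflect (forall m, #|A :&: coseg r m| <= #|B :&: coseg r m|) (best_cut A B r).
Proof.
move=> AB; apply: (iffP (best_cut_segP r AB)) => H m.
  have [mn|nm] := leqP m n; last by rewrite coseg_full ?setIT ?AB // ltnW.
  have := H (n - m); rewrite coseg_seg //.
  have := cardsID (seg r (n - m)) A; have := cardsID (seg r (n - m)) B.
  by rewrite !setDE -AB; lia.
have [mn|nm] := leqP m n; last by rewrite seg_full ?setIT ?AB // ltnW.
have := H (n - m); rewrite coseg_seg ?leq_subr // subKn //.
have := cardsID (seg r m) A; have := cardsID (seg r m) B.
by rewrite !setDE -AB; lia.
Qed.

(** The orders that start at a and at b differ by exchanging the two blocks
    [a, b - 1] and [b, a - 1], inside which they agree. *)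
Lemma shift_rank_block a b x y :
  (shift_rank a x < shift_rank a b) = (shift_rank a y < shift_rank a b) ->
  (shift_rank a y < shift_rank a x) = (shift_rank b y < shift_rank b x).
Proof.
rewrite !shift_rankE; have := ltn_ord a; have := ltn_ord b.
have := ltn_ord x; have := ltn_ord y.
by case: (leqP a b); case: (leqP a x); case: (leqP a y); case: (leqP b x);
  case: (leqP b y); lia.
Qed.

Lemma rev_rank_block a b x y :
  (shift_rank a x < shift_rank a b) = (shift_rank a y < shift_rank a b) ->
  (rev_rank a y < rev_rank a x) = (rev_rank b y < rev_rank b x).
Proof.
move=> /esym/shift_rank_block; rewrite /rev_rank => E.
have := shift_rank_lt a x; have := shift_rank_lt a y.
have := shift_rank_lt b x; have := shift_rank_lt b y.
by move: E; lia.
Qed.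

Lemma seg_compl a b : seg b (n - shift_rank a b) = ~: seg a (shift_rank a b).
Proof.
apply/setP=> x; rewrite !inE !shift_rankE; have := ltn_ord a; have := ltn_ord b.
have := ltn_ord x.
by case: (leqP a b); case: (leqP a x); case: (leqP b x); lia.
Qed.

Lemma cyc_int_seg (a j : 'I_n) :
  cyc_int n a.+1 j.+1 = seg a (shift_rank a j).+1.
Proof.
apply/setP=> x; rewrite !inE !shift_rankE; have := ltn_ord a; have := ltn_ord j.
have := ltn_ord x.
by case: (leqP a j); case: (leqP a x); case: (leqP a.+1 j.+1); lia.
Qed.

Lemma cyc_int_coseg (a j : 'I_n) : cyc_int n j.+1 a = coseg a (rev_rank a j).+1.
Proof.
apply/setP=> x; rewrite !inE /rev_rank !shift_rankE; have := ltn_ord a.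
have := ltn_ord j; have := ltn_ord x.
by case: (leqP a j); case: (leqP a x); case: (leqP j.+1 a); lia.
Qed.

End Cuts.

Notation seg r := (below (shift_rank r)).
Notation coseg r := (below (rev_rank r)).

(** The head y of t, counted by the bound y.+1, forces an entry of s that is at
    most y, so the heads compare and can be removed. *)
Lemma all2_leq_sorted (s t : seq nat) : sorted leq s -> sorted leq t ->
  reflect (size s = size t /\
           forall m, count (fun x => x < m) t <= count (fun x => x < m) s)
          (all2 leq s t).
Proof.
move=> ss st; apply: (iffP idP) => [|[]].
  elim: s t {ss st} => [|x s IHs] [|y t] //= /andP[xy /IHs[-> le]].
  by split=> // m; apply: leq_add (le m); case: (ltnP y m) => //=; lia.
elim: s t ss st => [|x s IHs] [|y t] //= sx sy [Es] le.
have [xs yt] : all (leq x) s /\ all (leq y) t.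
  by split; apply: order_path_min => //; apply: leq_trans.
have xy : x <= y.
  rewrite leqNgt; apply/negP => yx; have := le y.+1; rewrite ltnSn ltnNge yx /=.
  rewrite [X in _ <= X]add0n.
  have -> : count (fun z => z < y.+1) s = 0; last by [].
  apply/eqP; rewrite -leqn0 leqNgt -has_count -all_predC.
  by apply: sub_all xs => z /=; lia.
rewrite xy /=.
apply: IHs => //; [exact: path_sorted sx | exact: path_sorted sy |].
move=> m; have := le m; case: (ltnP y m) => ym.
  by rewrite (leq_ltn_trans xy ym).
have -> : count (fun z => z < m) t = 0; last by [].
apply/eqP; rewrite -leqn0 leqNgt -has_count -all_predC.
by apply: sub_all yt => z /=; lia.
Qed.

Lemma shift_set_leE n (r : 'I_n) (A B : {set 'I_n}) :
  shift_set_le r A B = (#|A| == #|B|) && best_cut A B r.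
Proof.
pose f := shift_rank r.
have E : all2 (shift_le r) =2 (fun s t => all2 leq (map f s) (map f t)).
  by elim=> [|x s IHs] [|y t] //=; rewrite IHs.
have Esort s : map f (sort (shift_le r) s) = sort leq (map f s).
  by rewrite (sort_map (leT := leq)).
rewrite /shift_set_le E !Esort.
have Ecount (D : {set 'I_n}) m :
    count (fun x => x < m) (sort leq (map f (enum D))) = #|D :&: seg r m|.
  rewrite (seq.permP (permEl (perm_sort _ _))) count_map -size_filter cardE.
  apply/perm_size/uniq_perm; first exact/filter_uniq/enum_uniq.
    exact: enum_uniq.
  by move=> x; rewrite mem_filter !mem_enum !inE andbC.
have sorted_sort (t : seq nat) : sorted leq (sort leq t).
  exact: sort_sorted leq_total t.
apply/(sameP (all2_leq_sorted (sorted_sort _) (sorted_sort _))).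
rewrite !size_sort !size_map -!cardE.
apply: (iffP andP) => [[/eqP AB /(best_cut_segP _ AB) H]|[AB H]].
  by split=> // m; rewrite !Ecount.
split; first exact/eqP.
by apply/best_cut_segP => // m; have := H m; rewrite !Ecount.
Qed.

(** * Inversions and gaps along an edge *)

Section Perms.
Variable n : nat.
Implicit Types (u v w : 'S_n) (i j : 'I_n).

Lemma perm_leq_ltn w i j : i < j -> w j <= w i -> w j < w i.
Proof.
move=> ij wji; rewrite ltn_neqAle wji andbT.
by rewrite (inj_eq val_inj) (inj_eq perm_inj) neq_ltn ij orbT.
Qed.

Lemma sum_split2 i j (F : 'I_n -> nat) : i != j ->
  \sum_p F p = F i + F j + \sum_(p | (p != i) && (p != j)) F p.
Proof.
by move=> ij; rewrite (bigD1 i) //= (bigD1 j) 1?eq_sym //= addnA.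
Qed.

Lemma sum_pairs_split2 i j (T : 'I_n -> 'I_n -> nat) : i != j ->
  \sum_p \sum_q T p q =
    T i i + T i j + T j i + T j j
    + \sum_(p | (p != i) && (p != j)) (T i p + T j p + T p i + T p j)
    + \sum_(p | (p != i) && (p != j)) \sum_(q | (q != i) && (q != j)) T p q.
Proof.
move=> ij; under eq_bigr => p _ do rewrite (sum_split2 (T p) ij).
rewrite (sum_split2 _ ij).
by rewrite !big_split /=; lia.
Qed.

Lemma inv_length_sum w : inv_length w =
  \sum_(p : 'I_n) \sum_(q : 'I_n) ((p < q) && (w q < w p)).
Proof.
rewrite pair_bigA /= /inv_length -sum1_card big_mkcond.
by apply: eq_bigr => p _; rewrite inE; case: ifP.
Qed.

(** Only pairs that meet {i, j} change; a position p contributes two new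
    inversions when both p and its value lie strictly in between. *)
Lemma inv_length_tperm w i j : i < j -> w i < w j ->
  inv_length (tperm i j * w)%g = inv_length w + 1
    + 2 * \sum_(p : 'I_n) ((i < p < j) && (w i < w p < w j)).
Proof.
move=> ij wij; have nij : i != j by rewrite neq_ltn ij.
pose w' := (tperm i j * w)%g.
have wi : w' i = w j by rewrite permM tpermL.
have wj : w' j = w i by rewrite permM tpermR.
have wp p : (p != i) && (p != j) -> w' p = w p.
  by case/andP=> pi pj; rewrite permM tpermD // eq_sym.
rewrite -/w' !inv_length_sum !(sum_pairs_split2 _ nij) wi wj.
rewrite (sum_split2 (fun p => (i < p < j) && (w i < w p < w j))%N nij).
under [X in _ + X + _ = _]eq_bigr => p pij do rewrite (wp p pij).
under [X in _ + X = _]eq_bigr => p pij.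
  under eq_bigr => q qij do rewrite (wp p pij) (wp q qij); over.
set S := (X in _ + X = _).
(* the four pairs formed by p with i and j, compared termwise *)
have -> : \sum_(p | (p != i) && (p != j))
    (((i < p) && (w p < w j)) + ((j < p) && (w p < w i))
     + ((p < i) && (w j < w p)) + ((p < j) && (w i < w p))) =
    \sum_(p | (p != i) && (p != j))
    (((i < p) && (w p < w i)) + ((j < p) && (w p < w j))
     + ((p < i) && (w i < w p)) + ((p < j) && (w j < w p)))
    + 2 * \sum_(p | (p != i) && (p != j))
        ((i < p < j) && (w i < w p < w j)).
  rewrite big_distrr -big_split /=; apply: eq_bigr => p /andP[pi pj].
  have : w p != w i by rewrite (inj_eq perm_inj).
  have : w p != w j by rewrite (inj_eq perm_inj).
  by move: pi pj; rewrite -!val_eqE /=; lia.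
by rewrite !ltnn ij wij; lia.
Qed.

Definition total_gap u v :=
  \sum_(k < n.-1) gap (init_set u k.+1) (init_set v k.+1).

Lemma cnt_init_set w k c :
  cnt (init_set w k) c = \sum_(p : 'I_n) ((p < k) && (w p < c)).
Proof.
rewrite /cnt -sum1_card big_mkcond /= (reindex_inj (@perm_inj _ w)) /=.
apply: eq_bigr => p _; rewrite !inE mem_imset ?inE; last exact: perm_inj.
by case: ifP.
Qed.

Lemma card_init_set w k : k <= n -> #|init_set w k| = k.
Proof.
move=> kn; rewrite card_imset; last exact: perm_inj.
rewrite -sum1_card (eq_bigl (fun p : 'I_n => p < k)).
  by rewrite (big_ord_narrow kn) sum1_card card_ord.
by move=> p; rewrite inE.
Qed.

(** Stated additively on both sides to avoid truncated subtraction: for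
    i < k <= j the value w i is exchanged for w j. *)
Lemma cnt_init_set_tperm w i j k c : i < j ->
  cnt (init_set (tperm i j * w)%g k) c + ((i < k <= j) && (w i < c)) =
  cnt (init_set w k) c + ((i < k <= j) && (w j < c)).
Proof.
move=> ij; have nij : i != j by rewrite neq_ltn ij.
rewrite !cnt_init_set !(sum_split2 _ nij) !permM tpermL tpermR.
have wp p : (p != i) && (p != j) -> (tperm i j * w)%g p = w p.
  by case/andP=> pi pj; rewrite permM tpermD // eq_sym.
under eq_bigr => p pij do rewrite (wp p pij).
by lia.
Qed.

Lemma sum_interval (a b m : nat) : b <= m -> \sum_(k < m) (a <= k < b) = b - a.
Proof.
move=> bm; rewrite -(big_mkord xpredT (fun k => nat_of_bool (a <= k < b))) /=.
elim: m b bm => [|m IHm] b bm; first by rewrite big_geq //; lia.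
rewrite big_nat_recr //=; have [b_le|b_gt] := leqP b m.
  by rewrite IHm //; lia.
rewrite big_nat; under eq_bigr => k km.
  have -> : (a <= k < b) = (a <= k < m) by lia.
  over.
by rewrite -big_nat IHm //; lia.
Qed.

(** A quantum edge has gap 1 at the levels i < k <= j, witnessed by the cut w i:
    these are the exponents of q_(i+1) ... q_j carried by the edge. *)
Lemma total_gap_tperm w i j : i < j ->
  total_gap w (tperm i j * w)%g = if w i < w j then 0 else j - i.
Proof.
move=> ij; case: ifP => wij; rewrite /total_gap.
  apply: big1 => k _; apply/eqP; rewrite -leqn0; apply/bigmax_leqP => c _.
  by have := cnt_init_set_tperm w k.+1 c ij; lia.
have {}wij : w j < w i by apply: perm_leq_ltn => //; rewrite leqNgt wij.
have E (k : 'I_n.-1) : true ->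
    gap (init_set w k.+1) (init_set (tperm i j * w)%g k.+1) = (i <= k < j).
  move=> _; apply/eqP; rewrite eqn_leq; apply/andP; split.
    apply/bigmax_leqP => c _.
    by have := cnt_init_set_tperm w k.+1 c ij; lia.
  have := cnt_le_gap (init_set w k.+1) (init_set (tperm i j * w)%g k.+1) (w i).
  by have := cnt_init_set_tperm w k.+1 (w i) ij; lia.
rewrite (eq_bigr _ E) {E}.
have jn : j <= n.-1 by have := ltn_ord j; lia.
exact: sum_interval.
Qed.

End Perms.

(** * Distances in the quantum Bruhat graph *)

Section Dist.
Variable n : nat.
Implicit Types (u v w : 'S_n) (i j : 'I_n).

Lemma total_gap_triangle u v w : total_gap u v <= total_gap u w + total_gap w v.
Proof. by rewrite -big_split; apply: leq_sum => k _; apply: gap_triangle. Qed.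

Lemma total_gapxx u : total_gap u u = 0.
Proof. by apply: big1 => k _; apply: gapxx. Qed.

(** For an edge, one of the two length conditions is ruled out by the relative
    order of u i and u j, so that the term 2 (j - i) appears exactly when the
    gap does. *)
Lemma qb_edge_length u w : qb_edge u w ->
  inv_length w + 2 * total_gap u w = inv_length u + 1.
Proof.
case/existsP=> i /existsP[j /and3P[ij /eqP-> H]].
rewrite (total_gap_tperm _ ij); case: ifP => uij.
  by have := inv_length_tperm ij uij; move: H; lia.
have {}uij : u j < u i by apply: perm_leq_ltn => //; rewrite leqNgt uij.
have := @inv_length_tperm _ (tperm i j * u)%g i j ij.
rewrite mulgA tperm2 mul1g !permM tpermL tpermR => /(_ uij).
by move: H; lia.
Qed.

Lemma path_length_ge u p : path (@qb_edge n) u p ->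
  inv_length (last u p) + 2 * total_gap u (last u p) <= inv_length u + size p.
Proof.
elim: p u => [|w p IHp] u /=; first by rewrite total_gapxx; lia.
case/andP=> /qb_edge_length uw /IHp; have := total_gap_triangle u (last w p) w.
by lia.
Qed.

(** The cyclic interval ]a, b], empty for a = b. *)
Definition cyc_between (a b x : 'I_n) := 0 < shift_rank a x <= shift_rank a b.

(** The arc from d to b stays inside the arc that ends at b. *)
Lemma cyc_between_tail (a b d x : 'I_n) : cyc_between a b d ->
  shift_rank d x <= shift_rank d b -> cyc_between a b x.
Proof.
rewrite /cyc_between !shift_rankE; have := ltn_ord a; have := ltn_ord b.
have := ltn_ord d; have := ltn_ord x.
by case: (leqP a d); case: (leqP a b); case: (leqP a x); case: (leqP d x);
  case: (leqP d b); lia.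
Qed.

(** When a is replaced by b in a set, the number of elements below a cut d
    changes by [b < d] - [a < d]: a constant, the value at c, for d outside the
    interval, and one less inside. *)
Lemma cyc_between_cut (a b c d : 'I_n) : ~~ cyc_between a b c ->
  (b < d) + (a < c) + cyc_between a b d = (a < d) + (b < c).
Proof.
rewrite /cyc_between !shift_rankE; have := ltn_ord a; have := ltn_ord b.
have := ltn_ord c; have := ltn_ord d.
by case: (leqP a b); case: (leqP a c); case: (leqP a d); lia.
Qed.

(** If u i < u j this is a Bruhat cover. Otherwise every value at a position
    between i and j lies in ]u j, u i[, so that the length drops by the largest
    possible amount 2 (j - i) - 1. *)
Lemma qb_edge_tperm u i j : i < j ->
  (forall p : 'I_n, i < p < j -> ~~ cyc_between (u i) (u j) (u p)) ->
  qb_edge u (tperm i j * u)%g.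
Proof.
move=> ij H; apply/existsP; exists i; apply/existsP; exists j.
rewrite ij eqxx /=.
have [uij|uji] := ltnP (u i) (u j).
  apply/orP; left; rewrite (inv_length_tperm ij uij) big1 ?muln0 ?addn0 //.
  move=> p _; apply/eqP; rewrite eqb0; apply/negP => /andP[/H].
  rewrite /cyc_between !shift_rankE.
  have := ltn_ord (u p); have := ltn_ord (u i).
  by case: (leqP (u i) (u p)); case: (leqP (u i) (u j)); lia.
have {}uji := perm_leq_ltn ij uji.
apply/orP; right.
have := @inv_length_tperm _ (tperm i j * u)%g i j ij.
rewrite mulgA tperm2 mul1g !permM tpermL tpermR => /(_ uji) ->.
rewrite (eq_bigr (fun p : 'I_n => nat_of_bool (i < p < j))); last first.
  move=> p _; case ipj: (i < p < j) => //=.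
  have ip : p != i by rewrite -val_eqE /=; lia.
  have jp : p != j by rewrite -val_eqE /=; lia.
  rewrite permM tpermD 1?eq_sym //.
  have := H p ipj; rewrite /cyc_between !shift_rankE.
  have : u p != u i by rewrite (inj_eq perm_inj).
  have : u p != u j by rewrite (inj_eq perm_inj).
  rewrite -!val_eqE /=; have := ltn_ord (u p); have := ltn_ord (u i).
  by case: (leqP (u i) (u p)); case: (leqP (u i) (u j)); lia.
suff -> : \sum_(p < n) (i < p < j) = j - i.+1 by lia.
by rewrite (sum_interval i.+1 (ltnW (ltn_ord j))).
Qed.

(** Take i the first position where u and v differ, and j the first later one
    with u j cyclically in ]u i, v i]. By minimality of j, exchanging the values
    at i and j is an edge. For i < k <= j, v_k has strictly more elements than
    u_k on each arc from an element of ]u i, v i] to v i, namely v i itself, so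
    no best cut of (u_k, v_k) lies in ]u i, v i]. Outside ]u i, u j], replacing
    u i by u j changes the excess by a constant, so best cuts stay best. *)
Lemma qb_edge_between u v : u != v -> exists w, qb_edge u w /\
  forall k, k <= n ->
    gap (init_set u k) (init_set w k) + gap (init_set w k) (init_set v k)
      = gap (init_set u k) (init_set v k).
Proof.
move=> uv; have [i [ui mini]] :
    exists i : 'I_n, u i != v i /\ forall p : 'I_n, p < i -> u p = v p.
  have [i0 ui0] : exists i, u i != v i.
    apply/existsP; rewrite -negb_forall; apply: contra uv => /forallP H.
    by apply/eqP/permP => i; apply/eqP.
  have [i ui mini] :=
    @arg_minnP _ i0 (fun i : 'I_n => u i != v i) (fun i : 'I_n => i : nat) ui0.
  exists i; split=> // p pi.
  by apply/eqP; apply: contraLR pi => /mini; rewrite -leqNgt.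
have [j [ij uj minj]] : exists j : 'I_n,
    [/\ i < j, cyc_between (u i) (v i) (u j)
      & forall p : 'I_n, i < p < j -> ~~ cyc_between (u i) (v i) (u p)].
  pose P (p : 'I_n) := (i < p) && cyc_between (u i) (v i) (u p).
  have Pj0 : P ((u^-1)%g (v i)).
    rewrite /P permKV; apply/andP; split; last first.
      rewrite /cyc_between leqnn andbT lt0n.
      apply: contraNneq ui => E; apply/eqP/(@shift_rank_inj _ (u i)).
      by rewrite E shift_rankE leqnn subnn.
    rewrite ltnNge leq_eqVlt negb_or; apply/andP; split.
      by apply: contra ui => /eqP/val_inj E; rewrite -{1}E permKV.
    by apply/negP=> /[dup] /mini; rewrite permKV => /perm_inj <-; rewrite ltnn.
  have [j /andP[ij uj] minj] :=
    @arg_minnP _ _ P (fun i : 'I_n => i : nat) Pj0.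
  exists j; split=> // p /andP[ip pj].
  apply: contraL pj => upv; rewrite -leqNgt; apply: minj.
  by rewrite /P ip.
have uij_between (d : 'I_n) :
    cyc_between (u i) (u j) d -> cyc_between (u i) (v i) d.
  rewrite /cyc_between => /andP[-> le]; apply: leq_trans le _.
  by case/andP: uj.
exists (tperm i j * u)%g; split.
  by apply: qb_edge_tperm => // p /minj; apply: contra; apply: uij_between.
move=> k kn; have := fun c => cnt_init_set_tperm u k c ij.
set A := init_set u k; set B := init_set v k; set A' := init_set _ k => EA'.
have n0 : 0 < n by apply: leq_ltn_trans (ltn_ord i).
have [c cAB] := best_cut_exists A B n0.
apply/eqP; rewrite -(best_cut_between _ cAB).
have [ikj|ikj] := boolP (i < k <= j); last first.
  have E d : cnt A' d = cnt A d by have := EA' d; lia.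
  by apply/andP; split; apply/best_cutP => d;
    have /best_cutP/(_ d) := cAB; rewrite !E; lia.
have vi_notin (p : 'I_n) : p < k -> p != i -> u p != v i.
  move=> pk pi; case: (ltnP p i) => [/[dup] /mini -> lt|ip].
    by rewrite (inj_eq perm_inj).
  have ipj : i < p < j by move: pi; rewrite -val_eqE /=; lia.
  apply: contraNneq (minj p ipj) => ->; rewrite /cyc_between leqnn andbT.
  by case/andP: uj => lt le; apply: leq_trans lt le.
have best_notin (d : 'I_n) : best_cut A B d -> ~~ cyc_between (u i) (v i) d.
  have AB : #|A| = #|B| by rewrite !card_init_set.
  move=> /(best_cut_segP _ AB) H; apply/negP => dE.
  (* the arc from d to v i *)
  have := H (shift_rank d (v i)).+1; apply/negP; rewrite -ltnNge.
  apply/proper_card/properP; split; last first.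
    exists (v i); rewrite !inE ltnSn ?andbT.
      by apply/imsetP; exists i => //; rewrite inE; lia.
    apply/imsetP => -[p]; rewrite inE => pk /esym/eqP; apply/negP.
    by have [->|pi] := eqVneq p i => //; apply: vi_notin.
  apply/subsetP => x; rewrite !inE => /andP[/imsetP[p]]; rewrite inE => pk ->.
  move=> lt; rewrite lt andbT.
  have upE := cyc_between_tail dE lt.
  have pi : p != i.
    apply: contraTneq upE => ->.
    by rewrite /cyc_between shift_rankE leqnn subnn.
  case: (ltnP p i) => [/mini ->|ip].
    by rewrite mem_imset ?inE //; exact: perm_inj.
  have ipj : i < p < j by move: pi; rewrite -val_eqE /=; lia.
  by have := minj p ipj; rewrite upE.
have cE : ~~ cyc_between (u i) (u j) c.
  exact: contra (@uij_between c) (best_notin c cAB).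
have shift_cut d := cyc_between_cut d cE.
move: (EA' c); rewrite ikj /= => EA'c.
apply/andP; split; apply/best_cutP => d; have := EA' d; have := shift_cut d;
  rewrite ikj /=; move: EA'c;
  move: (nat_of_bool (u j < d)) (nat_of_bool (u j < c))
        (nat_of_bool (u i < d)) (nat_of_bool (u i < c)) => ujd ujc uid uic.
  by lia.
have := cnt_le_gap A B d; move/eqP: cAB => cAB.
case: (boolP (cyc_between (u i) (u j) d)) => [/uij_between dE|_]; last by lia.
have : ~~ best_cut A B d by apply: contraTN dE => /best_notin.
by rewrite /best_cut; lia.
Qed.

Lemma qb_geodesic u v : exists p, [/\ path (@qb_edge n) u p, last u p = v &
  inv_length v + 2 * total_gap u v = inv_length u + size p].
Proof.
(* N only keeps the measure of the induction non-negative. *)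
pose N := #|{: 'I_n * 'I_n}|.
have leN w : inv_length w <= N by apply: max_card.
have [m] := ubnP (inv_length v + 2 * total_gap u v + (N - inv_length u)).
elim: m u => // m IHm u ltm.
have [<-|uv] := eqVneq u v.
  by exists [::]; rewrite /= total_gapxx; split=> //; lia.
have [w [uw gapw]] := qb_edge_between uv.
have {}gapw : total_gap u w + total_gap w v = total_gap u v.
  rewrite -big_split; apply: eq_bigr => k _; apply: gapw.
  by have := ltn_ord k; lia.
have Ew := qb_edge_length uw.
have [|p [wp pv Ep]] := IHm w; first by have := leN w; have := leN u; lia.
by exists (w :: p); split; rewrite /= ?uw //; lia.
Qed.

(** The search for the distance stops before #|'S_n| steps: a path of minimal
    length visits no vertex twice. *)
Lemma qb_distE u v :
  qb_dist u v + inv_length u = inv_length v + 2 * total_gap u v.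
Proof.
have [p0 [up0 p0v Ep0]] := qb_geodesic u v.
have [p [up uniq_p pv Ep]] : exists p,
    [/\ path (@qb_edge n) u p, uniq (u :: p), last u p = v
      & inv_length v + 2 * total_gap u v = inv_length u + size p].
  case: (shortenP up0) p0v => p up uniq_p sub_p pv; exists p; split=> //.
  have := path_length_ge up; rewrite pv Ep0 leq_add2l => le_p0p.
  congr (_ + _); apply/eqP; rewrite eqn_leq le_p0p.
  by rewrite uniq_leq_size //; case/andP: uniq_p.
have lt_p : size p < #|{: 'S_n}|.
  by rewrite -[_.+1]/(size (u :: p)) -(card_uniqP uniq_p) max_card.
pose has_path k :=
  [exists q : k.-tuple 'S_n, path (@qb_edge n) u q && (last u q == v)].
rewrite /qb_dist -/has_path.
have has_p : has_path (size p).
  by apply/existsP; exists (in_tuple p); rewrite /= up pv eqxx.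
have no_shorter k : has_path k -> size p <= k.
  case/existsP=> q /andP[uq /eqP qv].
  by have := path_length_ge uq; rewrite qv size_tuple; lia.
suff -> : find has_path (iota 0 #|{: 'S_n}|) = size p by lia.
have has_s : has has_path (iota 0 #|{: 'S_n}|).
  by apply/hasP; exists (size p) => //; rewrite mem_iota.
apply/eqP; rewrite eqn_leq; apply/andP; split.
  rewrite leqNgt; apply/negP=> /(before_find 0).
  by rewrite nth_iota // add0n has_p.
apply: no_shorter; have := nth_find 0 has_s; rewrite nth_iota //.
by rewrite -[X in _ < X](size_iota 0) -has_find.
Qed.

(** The gaps are subadditive at each level, so the distances add up iff all
    levels do. *)
Lemma tilted_leE u w v : tilted_le u w v =
  [forall k : 'I_n.-1, gap (init_set u k.+1) (init_set w k.+1)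
     + gap (init_set w k.+1) (init_set v k.+1)
       == gap (init_set u k.+1) (init_set v k.+1)].
Proof.
have Euv := qb_distE u v; have Ewv := qb_distE w v; have Euw := qb_distE u w.
rewrite /tilted_le.
have -> : (qb_dist u w + qb_dist w v == qb_dist u v) =
   (total_gap u v == total_gap u w + total_gap w v) by lia.
rewrite /total_gap -big_split /=.
have le k : true -> gap (init_set u k.+1) (init_set v k.+1) <=
  gap (init_set u k.+1) (init_set w k.+1)
    + gap (init_set w k.+1) (init_set v k.+1)
   ?= iff (gap (init_set u k.+1) (init_set w k.+1)
     + gap (init_set w k.+1) (init_set v k.+1)
       == gap (init_set u k.+1) (init_set v k.+1)).
  by move=> _; split; [exact: gap_triangle | exact: eq_sym].
rewrite (leqif_sum (fun (k : 'I_n.-1) => le k)).2.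
by apply: eq_forallb => k.
Qed.

Lemma vec_leE (a : 'I_n.-1 -> 'I_n) u v : vec_le a u v =
  [forall k : 'I_n.-1, best_cut (init_set u k.+1) (init_set v k.+1) (a k)].
Proof.
apply: eq_forallb => k; rewrite shift_set_leE !card_init_set ?eqxx //;
by have := ltn_ord k; lia.
Qed.

Lemma vec_le_exists u v : exists a, vec_le a u v.
Proof.
have /fin_all_exists[a Ha] (k : 'I_n.-1) :
    exists c, best_cut (init_set u k.+1) (init_set v k.+1) c.
  by apply: best_cut_exists; have := ltn_ord k; lia.
by exists a; rewrite vec_leE; apply/forallP.
Qed.

Lemma vec_le_trans a u w v : vec_le a u w -> vec_le a w v -> vec_le a u v.
Proof.
rewrite !vec_leE => /forallP uw /forallP wv; apply/forallP => k.
exact: best_cut_trans (uw k) (wv k).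
Qed.

Theorem tilted_le_vec_le a u w v :
  vec_le a u v -> tilted_le u w v = vec_le a u w && vec_le a w v.
Proof.
rewrite !vec_leE tilted_leE => /forallP uv.
apply/forallP/andP => [H|[/forallP uw /forallP wv] k]; last first.
  by rewrite -(best_cut_between _ (uv k)) uw wv.
by split; apply/forallP => k; have := H k;
   rewrite -(best_cut_between _ (uv k)) => /andP[].
Qed.

Corollary tilted_interval a u x y v : vec_le a u v ->
  tilted_le u x y && tilted_le u y v =
  [&& vec_le a u x, vec_le a x y & vec_le a y v].
Proof.
move=> uv; rewrite (tilted_le_vec_le _ uv).
apply/andP/and3P => [[uxy /andP[uy yv]]|[ux xy yv]].
  by move: uxy; rewrite (tilted_le_vec_le _ uy) => /andP[].
have uy := vec_le_trans ux xy.
by rewrite (tilted_le_vec_le _ uy) ux xy uy yv.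
Qed.

End Dist.

(** * Ranks of coordinate projections *)

Section Rank.
Variables (F : fieldType) (n : nat).
Local Notation V := 'rV[F]_n.
Implicit Types (U W : {vspace V}) (S T P : {set 'I_n}).

Definition restr S : 'Hom(V, 'rV[F]_#|S|) :=
  linfun (colsub (fun j : 'I_#|S| => enum_val j)).

Definition rk U S := \dim (restr S @: U)%VS.

Lemma mem_ker_proj S (x : V) :
  reflect (forall j, j \in S -> x ord0 j = 0%R) (x \in lker (restr S)).
Proof.
rewrite memv_ker /restr lfunE /=.
apply: (iffP eqP) => [/rowP H j jS|H]; last first.
  by apply/rowP => j; rewrite !mxE H // enum_valP.
by have := H (enum_rank_in jS j); rewrite !mxE enum_rankK_in.
Qed.

Lemma rk_ker U S : rk U S + \dim (U :&: lker (restr S)) = \dim U.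
Proof. by rewrite addnC limg_ker_dim. Qed.

Lemma ker_projS S T : S \subset T ->
  (lker (restr T) <= lker (restr S))%VS.
Proof.
move=> /subsetP ST; apply/subvP => x /mem_ker_proj H.
by apply/mem_ker_proj => j /ST; apply: H.
Qed.

(** For U = W this is submodularity; for S inside T it says that the rank
    increments of a subspace are at most those of the larger space. Both come
    from the dimension formula for the vectors of U that vanish on S and those
    of W that vanish on T. *)
Lemma rk_submod U W S T : (U <= W)%VS ->
  rk U (S :|: T) + rk W (S :&: T) <= rk U S + rk W T.
Proof.
move=> UW; pose K S := lker (restr S).
have capE : (U :&: K S :&: (W :&: K T))%VS = (U :&: K (S :|: T))%VS.
  apply/vspaceP => x; rewrite !memv_cap; apply/idP/idP.
    move=> /andP[/andP[-> /mem_ker_proj xS] /andP[_ /mem_ker_proj xT]].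
    by apply/mem_ker_proj => j; rewrite inE => /orP[/xS|/xT].
  move=> /andP[xU xST]; rewrite xU (subvP UW _ xU) /=.
  by apply/andP; split; apply: subvP xST; apply: ker_projS;
    [exact: subsetUl | exact: subsetUr].
have subE : (U :&: K S + W :&: K T <= W :&: K (S :&: T)%SET)%VS.
  rewrite subv_add !subv_cap (subv_trans (capvSl _ _) UW) capvSl /=.
  by rewrite !(subv_trans (capvSr _ _)) ?ker_projS ?subsetIl ?subsetIr.
have := dimvS subE; have := dimv_sum_cap (U :&: K S) (W :&: K T).
rewrite capE; have := rk_ker U S; have := rk_ker W T.
have := rk_ker U (S :|: T); have := rk_ker W (S :&: T); rewrite /K.
by lia.
Qed.

Lemma rk_le_card U S : rk U S <= #|S|.
Proof.
by apply: leq_trans (dimvS (subvf _)) _; rewrite dimvf /dim /= mul1n.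
Qed.

Lemma rk0 U : rk U set0 = 0.
Proof. by apply/eqP; rewrite -leqn0 -(@cards0 'I_n) rk_le_card. Qed.

Lemma rkT U : rk U setT = \dim U.
Proof.
rewrite -(rk_ker U setT); suff -> : (U :&: lker (restr setT))%VS = 0%VS.
  by rewrite dimv0 addn0.
apply/eqP; rewrite -subv0; apply/subvP => x; rewrite memv_cap memv0.
move=> /andP[_ /mem_ker_proj H]; apply/eqP/rowP => j.
by rewrite mxE H ?inE.
Qed.

Lemma rkS U S T : S \subset T -> rk U S <= rk U T.
Proof.
move=> /ker_projS ST; have := rk_ker U S; have := rk_ker U T.
by have := dimvS (capvS (subvv U) ST); lia.
Qed.

Lemma rkU1 U S j : rk U (j |: S) <= (rk U S).+1.
Proof.
have := rk_submod S [set j] (subvv U); have := rk_le_card U [set j].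
by rewrite cards1 setUC; lia.
Qed.

(** The hypothesis says that U is the sum of its parts supported on P and off P.
    The inequality for S that submodularity does not give directly comes from
    adding it for (S, P) and (S :|: P, ~: P). *)
Lemma rk_split U P S : rk U P + rk U (~: P) <= \dim U ->
  rk U S = rk U (S :&: P) + rk U (S :\: P).
Proof.
move=> dU; have := rk_submod S P (subvv U).
have := rk_submod (S :|: P) (~: P) (subvv U).
have := rk_submod (S :&: P) (S :\: P) (subvv U); rewrite finset.setID.
have -> : S :|: P :|: ~: P = setT.
  by apply/setP=> x; rewrite !inE -orbA orbN orbT.
have -> : (S :|: P) :&: ~: P = S :\: P.
  apply/setP=> x; rewrite !inE.
  by case: (x \in P); rewrite ?orbT ?orbF ?andbT ?andbF.
by rewrite rkT; lia.
Qed.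


(** The greedy basis of the matroid of U for the order given by f. *)
Definition jumps U (f : 'I_n -> nat) : {set 'I_n} :=
  [set x | rk U (below f (f x)) < rk U (x |: below f (f x))].

Lemma card_jumps U f m : injective f ->
  #|jumps U f :&: below f m| = rk U (below f m).
Proof.
move=> f_inj; elim: m => [|m IHm]; first by rewrite below0 setI0 cards0 rk0.
have [[x xm]|fm] := rank_hit f m; last by rewrite below_skip.
rewrite -xm belowS // in IHm *.
have xnot : x \notin below f (f x) by rewrite inE ltnn.
have := rkS U (subsetUr [set x] (below f (f x))).
have := rkU1 U (below f (f x)) x.
move Es: (rk U (x |: below f (f x))) => s.
have [xJ|xJ] := boolP (x \in jumps U f).
  rewrite setIUr (setIidPr _) ?sub1set // cardsU1 IHm inE (negPf xnot) andbF.
  by move: xJ; rewrite inE Es; lia.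
rewrite setIUr (_ : _ :&: [set x] = set0) ?set0U ?IHm.
  by move: xJ; rewrite inE Es; lia.
apply/setP=> y; rewrite !inE; apply/negP=> /andP[yJ /eqP E].
by move: yJ xJ; rewrite E inE => ->.
Qed.

Lemma jumps_unique A U f : injective f ->
  (forall m, #|A :&: below f m| = rk U (below f m)) -> A = jumps U f.
Proof.
move=> f_inj H; apply/setP=> x.
have {}H m : #|A :&: below f m| = #|jumps U f :&: below f m|.
  by rewrite card_jumps.
have mem (B : {set 'I_n}) :
    #|B :&: below f (f x).+1| = (x \in B) + #|B :&: below f (f x)|.
  rewrite belowS // setIUr; have [xB|xB] := boolP (x \in B).
    by rewrite (setIidPr _) ?sub1set // cardsU1 !inE ltnn andbF.
  rewrite (_ : _ :&: [set x] = set0) ?set0U //.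
  apply/setP=> y; rewrite !inE; apply/andP=> -[yB /eqP E].
  by move: xB; rewrite -E yB.
by have := H (f x).+1; rewrite !mem H => /addIn; do 2!case: (x \in _).
Qed.

Lemma jumps_sub U W f : (U <= W)%VS -> jumps U f \subset jumps W f.
Proof.
move=> UW; apply/subsetP => x; rewrite !inE.
have := rk_submod (below f (f x)) (x |: below f (f x)) UW.
rewrite (setUidPr (subsetUr _ _)) (setIidPl (subsetUr _ _)).
by move: (rk U (x |: _)) (rk W (x |: _)) => u w; lia.
Qed.

Lemma rk_split_jump U P S S' x : rk U P + rk U (~: P) <= \dim U ->
  (forall y, (y \in P) = (x \in P) -> (y \in S) = (y \in S')) ->
  (rk U S < rk U (x |: S)) = (rk U S' < rk U (x |: S')).
Proof.
wlog xP : P / x \in P => [IH|] dU SS'.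
  have [|xP] := boolP (x \in P); first by move/IH; apply.
  apply: (IH (~: P)); [by rewrite inE | by rewrite finset.setCK addnC |].
  by move=> y; rewrite !inE => /negb_inj; apply: SS'.
have SP : S :&: P = S' :&: P.
  apply/setP=> y; rewrite !inE.
  have [yP|] := boolP (y \in P); rewrite ?andbF ?andbT //.
  by apply: SS'; rewrite xP.
have xSP T : (x |: T) :&: P = x |: (T :&: P).
  by rewrite setIUl (setIidPl _) // sub1set.
have xSD T : (x |: T) :\: P = T :\: P.
  apply/setP=> y; rewrite !inE; case: eqP => //= ->; by rewrite xP.
rewrite (rk_split S dU) (rk_split (x |: S) dU).
rewrite (rk_split S' dU) (rk_split (x |: S') dU) !xSP !xSD SP.
by rewrite !ltn_add2r.
Qed.

(** If U splits along P, elements off P do not affect whether the rank jumps at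
    an element of P, and conversely. *)
Lemma jumps_block U P f g : rk U P + rk U (~: P) <= \dim U ->
  (forall x y, (y \in P) = (x \in P) -> (f y < f x) = (g y < g x)) ->
  jumps U f = jumps U g.
Proof.
move=> dU fg; apply/setP=> x; rewrite !inE.
by apply: (rk_split_jump dU) => y /fg; rewrite !inE.
Qed.

Lemma card_jumps_full U f : injective f -> #|jumps U f| = \dim U.
Proof.
move=> f_inj; rewrite -rkT -[jumps U f]setIT.
have -> : setT = below f (\max_x f x).+1; last exact: card_jumps.
by apply/esym/setP=> x; rewrite !inE ltnS leq_bigmax.
Qed.

(** The first greedy basis precedes the last one: a segment and its complement
    have ranks adding up to at least dim U. *)
Lemma jumps_best_cut U r :
  best_cut (jumps U (shift_rank r)) (jumps U (rev_rank r)) r.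
Proof.
have cX := card_jumps_full U (@shift_rank_inj n r).
have cY := card_jumps_full U (@rev_rank_inj n r).
apply/best_cut_segP => [|m]; first by rewrite cX cY.
rewrite card_jumps; last exact: shift_rank_inj.
have [mn|nm] := leqP m n; last by rewrite seg_full ?setIT ?rkT ?cY // ltnW.
have := card_jumps U (n - m) (@rev_rank_inj n r).
rewrite coseg_seg ?leq_subr // subKn // -setDE.
have := cardsID (seg r m) (jumps U (rev_rank r)); rewrite cY.
have := rk_submod (seg r m) (~: seg r m) (subvv U).
by rewrite finset.setUCr rkT; lia.
Qed.

(** The arc P from a to b meets both jump sets in the same number of elements,
    as a and b are best cuts. So P and its complement have complementary ranks,
    U splits along them, and the jumps depend only on the orders inside the two
    arcs. *)
Lemma jumps_change_cut U (a b : 'I_n) :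
  best_cut (jumps U (shift_rank a)) (jumps U (rev_rank a)) b ->
  jumps U (shift_rank a) = jumps U (shift_rank b) /\
  jumps U (rev_rank a) = jumps U (rev_rank b).
Proof.
set X := jumps U (shift_rank a); set Y := jumps U (rev_rank a) => Xb.
have cX : #|X| = \dim U := card_jumps_full U (@shift_rank_inj n a).
have cY : #|Y| = \dim U := card_jumps_full U (@rev_rank_inj n a).
pose p := shift_rank a b; pose P := seg a p.
have pn : p <= n by apply/ltnW/shift_rank_lt.
have rP : rk U P = #|X :&: P| by rewrite -card_jumps //; exact: shift_rank_inj.
have rQ : rk U (~: P) = #|Y :&: ~: P|.
  rewrite /P -[p](subKn pn) -coseg_seg ?leq_subr // -card_jumps //.
  exact: rev_rank_inj.
have XY : #|X| = #|Y| by rewrite cX cY.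
have dU : rk U P + rk U (~: P) <= \dim U.
  have := (best_cut_segP b XY Xb) (n - p); rewrite seg_compl.
  have := (best_cut_segP a XY (jumps_best_cut U a)) p.
  have := cardsID P X; have := cardsID P Y.
  by rewrite rP rQ !setDE /P /p; lia.
split; apply: (jumps_block dU) => x y; rewrite !inE => E.
  exact: (shift_rank_block (esym E)).
exact: (rev_rank_block (esym E)).
Qed.

End Rank.

(** * Common cuts and chains of sets *)

Section Chains.
Variable n : nat.
Implicit Types (A B C D : {set 'I_n}) (u v w x y : 'S_n).
Implicit Type X : nat -> {set 'I_n}.

(** By the cut a, the three gaps add up to gap A D, and so the three excesses
    are maximal at every best cut of (A, D). *)
Lemma best_cut_inner A B C D (a c : 'I_n) :
  best_cut A B a -> best_cut B C a -> best_cut C D a ->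
  best_cut A D c -> best_cut B C c.
Proof.
move=> AB BC CD; have := best_cut_trans (best_cut_trans AB BC) CD.
move: AB BC CD; rewrite /best_cut.
have := cnt_le_gap A B c; have := cnt_le_gap B C c; have := cnt_le_gap C D c.
by lia.
Qed.

(** Let g and g' be the two excess functions. A maximiser of g + g' maximises
    both: g' - g takes two adjacent values only, so where g is larger by at
    least 1, 2 g is larger by at least 2 while g' - g is smaller by at most 1,
    and g + g' would be larger too; likewise for g'. *)
Lemma common_best_cut A B (p q : 'I_n) : p \notin A -> q \notin B ->
  exists c, best_cut A B c && best_cut (p |: A) (q |: B) c.
Proof.
move=> pA qB.
have cntU1 (r : 'I_n) (E : {set 'I_n}) c : r \notin E ->
    cnt (r |: E) c = (r < c) + cnt E c.
  move=> rE; rewrite /cnt (cardsD1 r) !inE eqxx /=; congr (_ + _).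
  apply: eq_card => x; rewrite !inE; case: eqP => [->|//].
  by rewrite (negPf rE).
(* g + g', shifted by 2 n so that no subtraction is truncated *)
pose f (c : 'I_n) :=
  cnt B c + cnt (q |: B) c + (n - cnt A c) + (n - cnt (p |: A) c).
have le_n (E : {set 'I_n}) c : cnt E c <= n.
  by rewrite -[X in _ <= X]card_ord max_card.
have [c maxc] : exists c, forall d, f d <= f c.
  by have [c _ maxc] := @arg_maxnP _ p xpredT f isT; exists c => d; apply: maxc.
by exists c; apply/andP; split; apply/best_cutP => d; have := maxc d;
  rewrite /f; have := le_n A c; have := le_n A d;
  have := le_n (p |: A) c; have := le_n (p |: A) d;
  rewrite !cntU1 //; case: (ltnP p q) => pq; lia.
Qed.

Lemma init_setS w (k : 'I_n) : init_set w k.+1 = w k |: init_set w k.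
Proof.
rewrite /init_set -imsetU1.
have -> // : [set i : 'I_n | i < k.+1] = k |: [set i : 'I_n | i < k].
by apply/setP => i; rewrite !inE ltnS leq_eqVlt.
Qed.

Lemma notin_init_set w (k : 'I_n) : w k \notin init_set w k.
Proof. by rewrite mem_imset ?inE ?ltnn //; exact: perm_inj. Qed.

Lemma common_best_cut_init u v (k : 'I_n) : exists c,
  best_cut (init_set u k) (init_set v k) c &&
  best_cut (init_set u k.+1) (init_set v k.+1) c.
Proof.
by rewrite !init_setS; apply: common_best_cut; apply: notin_init_set.
Qed.

Lemma perm_of_chain X : (forall k, k <= n -> #|X k| = k) ->
  (forall k, k < n -> X k \subset X k.+1) ->
  exists w : 'S_n, forall k, k <= n -> init_set w k = X k.
Proof.
move=> cX sX; have sX' k l : k <= l -> l <= n -> X k \subset X l.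
  elim: l => [|l IHl]; first by rewrite leqn0 => /eqP->.
  rewrite leq_eqVlt => /orP[/eqP->//|kl] ln.
  by apply: subset_trans (sX l ln); apply: IHl => //; apply: ltnW.
have /fin_all_exists[f fP] (i : 'I_n) : exists z : 'I_n, z \in X i.+1 :\: X i.
  apply/set0Pn; rewrite -card_gt0 cardsD (setIidPr (sX i (ltn_ord i))).
  by rewrite !cX ?subSnn // ltnW.
have f_mem (i : 'I_n) k : i < k -> k <= n -> f i \in X k.
  move=> ik kn; apply: (subsetP (sX' i.+1 k ik kn)).
  by have := fP i; rewrite inE => /andP[].
have f_neq (i j : 'I_n) : i < j -> f i != f j.
  move=> ij; apply: contraTneq (f_mem i j ij (ltnW (ltn_ord j))) => ->.
  by have := fP j; rewrite inE => /andP[].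
have f_inj : injective f.
  move=> i j fij; case: (ltngtP i j) => [/f_neq|/f_neq|/val_inj//];
    by rewrite fij eqxx.
exists (perm f_inj) => k kn; apply/eqP.
rewrite eqEcard card_init_set // cX // leqnn andbT /init_set.
apply/subsetP => y /imsetP[j]; rewrite inE => jk ->.
by rewrite permE f_mem.
Qed.

Lemma init_set0 w : init_set w 0 = set0.
Proof. by apply/eqP; rewrite -cards_eq0 card_init_set. Qed.

Lemma init_set_full w : init_set w n = setT.
Proof.
by apply/eqP; rewrite eqEcard subsetT cardsT card_ord card_init_set /=.
Qed.

(** The components of a vector of cuts correspond to the levels strictly
    between 0 and n. *)
Variant init_index (k : nat) : Prop :=
| InitEmpty of k = 0
| InitFull of k = n
| InitInner (i : 'I_n.-1) of k = i.+1.

Lemma init_indexP k : k <= n -> init_index k.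
Proof.
case: k => [|k] kn; first exact: InitEmpty.
have [kn1|nk] := ltnP k n.-1; first exact: (@InitInner _ (Ordinal kn1)).
by apply: InitFull; lia.
Qed.

Lemma init_set_inj x y :
  (forall k : 'I_n.-1, init_set x k.+1 = init_set y k.+1) -> x = y.
Proof.
move=> H; have {}H k : k <= n -> init_set x k = init_set y k.
  move/init_indexP => [->|->|i ->]; by rewrite ?init_set0 ?init_set_full ?H.
apply/permP => k; have := notin_init_set x k.
rewrite (H k (ltnW (ltn_ord k))) => xk.
have : x k \in init_set y k.+1 by rewrite -H // init_setS inE set11.
by rewrite init_setS inE (negPf xk) orbF inE => /eqP.
Qed.

End Chains.

(** * Rank conditions as jump conditions *)

Section Layers.
Variables (F : fieldType) (n : nat) (U : {vspace 'rV[F]_n}).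
Implicit Types (A B : {set 'I_n}) (a c : 'I_n).

Lemma jumps_change_cut_between A B a c :
  best_cut A (jumps U (shift_rank a)) a ->
  best_cut (jumps U (rev_rank a)) B a ->
  best_cut A B c ->
  jumps U (shift_rank a) = jumps U (shift_rank c) /\
  jumps U (rev_rank a) = jumps U (rev_rank c).
Proof.
move=> AX YB ABc; apply: jumps_change_cut.
exact: best_cut_inner AX (jumps_best_cut U a) YB ABc.
Qed.

Lemma rank_le_best_cut A B a : #|A| = \dim U -> #|B| = \dim U ->
  (forall j : 'I_n,
    rk U (cyc_int n a.+1 j.+1) <= #|A :&: cyc_int n a.+1 j.+1| /\
    rk U (cyc_int n j.+1 a) <= #|B :&: cyc_int n j.+1 a|) <->
  best_cut A (jumps U (shift_rank a)) a /\ best_cut (jumps U (rev_rank a)) B a.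
Proof.
move=> cA cB; have sI := @shift_rank_inj n a; have rI := @rev_rank_inj n a.
have AX : #|A| = #|jumps U (shift_rank a)| by rewrite card_jumps_full.
have YB : #|jumps U (rev_rank a)| = #|B| by rewrite card_jumps_full.
split=> [H|[/(best_cut_segP _ AX) HA /(best_cut_cosegP _ YB) HB] j].
  split.
    apply/best_cut_segP => // m; rewrite card_jumps //.
    apply: (@below_ind _ _ (fun S => rk U S <= #|A :&: S|)) => [|j].
      by rewrite rk0.
    by rewrite -cyc_int_seg; case: (H j).
  apply/best_cut_cosegP => // m; rewrite card_jumps //.
  apply: (@below_ind _ _ (fun S => rk U S <= #|B :&: S|)) => [|j].
    by rewrite rk0.
  by rewrite -cyc_int_coseg; case: (H j).
by rewrite cyc_int_seg cyc_int_coseg -!card_jumps.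
Qed.

Lemma rank_eq_jumps A B a :
  (forall j : 'I_n,
    rk U (cyc_int n a.+1 j.+1) = #|A :&: cyc_int n a.+1 j.+1| /\
    rk U (cyc_int n j.+1 a) = #|B :&: cyc_int n j.+1 a|) <->
  A = jumps U (shift_rank a) /\ B = jumps U (rev_rank a).
Proof.
have sI := @shift_rank_inj n a; have rI := @rev_rank_inj n a.
split=> [H|[-> ->] j]; last by rewrite cyc_int_seg cyc_int_coseg !card_jumps.
split; apply: jumps_unique => //.
  apply: (@below_ind _ _ (fun S => #|A :&: S| = rk U S)) => [|j].
    by rewrite rk0 setI0 cards0.
  by rewrite -cyc_int_seg; case: (H j).
apply: (@below_ind _ _ (fun S => #|B :&: S| = rk U S)) => [|j].
  by rewrite rk0 setI0 cards0.
by rewrite -cyc_int_coseg; case: (H j).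
Qed.

End Layers.

(** * Flags *)

Section Flags.
Variables (R : realType) (n : nat).
Implicit Types (G : flag R n) (u v x y : 'S_n) (a : 'I_n.-1 -> 'I_n).

Lemma flag_sub G (i j : 'I_n.+1) : i <= j -> (G i <= G j)%VS.
Proof.
rewrite leq_eqVlt => /orP[/eqP/val_inj->|/(@flag_proper _ _ G)[]//].
exact: subvv.
Qed.

Lemma flag_dim_lt G (i j : 'I_n.+1) : i < j -> \dim (G i) < \dim (G j).
Proof.
move=> /(@flag_proper _ _ G)[Gij /eqP nGij].
by rewrite ltn_neqAle dimvS // andbT (dimv_leqif_eq Gij).2.
Qed.

Lemma flag_dim G k : k <= n -> \dim (G (inord k)) = k.
Proof.
move=> kn.
have up l : l <= n -> l <= \dim (G (inord l)).
  elim: l => // l IHl ln; apply: leq_ltn_trans (IHl (ltnW ln)) _.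
  by apply: flag_dim_lt; rewrite !inordK ?ltnS // ltnW.
have down l : l <= n -> \dim (G (inord (n - l))) <= n - l.
  elim: l => [|l IHl] ln.
    by rewrite (leq_trans (dimvS (subvf _))) // dimvf /dim /= mul1n subn0.
  have := IHl (ltnW ln); have -> : n - l = (n - l.+1).+1 by lia.
  move=> le; rewrite -ltnS; apply: leq_trans le; apply: flag_dim_lt.
  by rewrite !inordK; lia.
apply/eqP; rewrite eqn_leq up // andbT.
by have := down (n - k) (leq_subr _ _); rewrite subKn.
Qed.

Lemma inner_lt (i : 'I_n.-1) : i.+1 <= n.
Proof. by have := ltn_ord i; lia. Qed.

Lemma tilted_richardson_vecE u v a G : tilted_richardson_vec u v a G <->
  forall i : 'I_n.-1,
    best_cut (init_set u i.+1)
      (jumps (G (inord i.+1)) (shift_rank (a i))) (a i) /\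
    best_cut (jumps (G (inord i.+1)) (rev_rank (a i)))
      (init_set v i.+1) (a i).
Proof.
have H (i : 'I_n.-1) := @rank_le_best_cut _ _ (G (inord i.+1))
  (init_set u i.+1) (init_set v i.+1) (a i).
split=> HG i.
  by apply/H => [||j]; [rewrite card_init_set ?flag_dim ?inner_lt..|apply: HG].
by apply/H; rewrite ?card_init_set ?flag_dim ?inner_lt.
Qed.

Lemma open_tilted_richardson_vecE u v a G :
  open_tilted_richardson_vec u v a G <->
  forall i : 'I_n.-1,
    init_set u i.+1 = jumps (G (inord i.+1)) (shift_rank (a i)) /\
    init_set v i.+1 = jumps (G (inord i.+1)) (rev_rank (a i)).
Proof. by split=> HG i; apply/rank_eq_jumps; apply: HG. Qed.

(** As x_k and y_k are the jump sets at the cut prescribed by b, they are also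
    the jump sets at every other best cut of (x_k, y_k). *)
Lemma open_tilted_richardson_change_cut x y a b G :
  vec_le a x y -> open_tilted_richardson_vec x y b G ->
  open_tilted_richardson_vec x y a G.
Proof.
rewrite vec_leE => /forallP xy /open_tilted_richardson_vecE HG.
apply/open_tilted_richardson_vecE => i; have [xi yi] := HG i.
have := xy i; rewrite xi yi => /jumps_change_cut[<- <-].
by [].
Qed.

Lemma flag_position u v a G : vec_le a u v -> tilted_richardson_vec u v a G ->
  exists x y, [/\ vec_le a u x, vec_le a x y, vec_le a y v
    & open_tilted_richardson_vec x y a G].
Proof.
rewrite vec_leE => /forallP uv /tilted_richardson_vecE HG.
pose J (f : 'I_n -> 'I_n -> nat) (k : nat) c := jumps (G (inord k)) (f c).
(* Z k is the pair of jump sets for all best cuts of (u_k, v_k) at once, so that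
   levels k and k + 1 can be compared at a common best cut although a may
   prescribe different ones. *)
have /fin_all_exists[Z HZ] (k : 'I_n.+1) : exists Z : {set 'I_n} * {set 'I_n},
    forall c, best_cut (init_set u k) (init_set v k) c ->
      J (@shift_rank n) k c = Z.1 /\ J (@rev_rank n) k c = Z.2.
  have cJ f c : injective (f c) -> #|J f k c| = k.
    by move=> f_inj; rewrite card_jumps_full // flag_dim // -ltnS.
  have [k0|kn|i ki] := init_indexP (ltn_ord k : k <= n).
  - exists (set0, set0) => c _; split; apply/eqP; rewrite -cards_eq0 cJ ?k0 //.
      exact: shift_rank_inj.
    exact: rev_rank_inj.
  - exists (setT, setT) => c _; split; apply/eqP;
      rewrite eqEcard subsetT cardsT card_ord cJ ?kn //=.
      exact: shift_rank_inj.
    exact: rev_rank_inj.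
  exists (J (@shift_rank n) k (a i), J (@rev_rank n) k (a i)) => c.
  have [uX Yv] := HG i; rewrite /J ki => uvc.
  by have [-> ->] := jumps_change_cut_between uX Yv uvc.
have nested (k : nat) : k < n ->
    (Z (inord k)).1 \subset (Z (inord k.+1)).1 /\
    (Z (inord k)).2 \subset (Z (inord k.+1)).2.
  move=> kn; have [c /andP[ck ck1]] := common_best_cut_init u v (Ordinal kn).
  have G_sub : (G (inord k) <= G (inord k.+1))%VS.
    by apply: flag_sub; rewrite !inordK // ltnS // ltnW.
  have [|<- <-] := HZ (inord k) c; first by rewrite inordK // ltnS ltnW.
  have [|<- <-] := HZ (inord k.+1) c; first by rewrite inordK // ltnS.
  by rewrite /J !inordK ?ltnS // 1?ltnW // !jumps_sub.
have card_Z (k : nat) : k <= n ->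
    #|(Z (inord k)).1| = k /\ #|(Z (inord k)).2| = k.
  move=> kn; have kE : (inord k : 'I_n.+1) = k :> nat by rewrite inordK.
  case: (posnP n) => [n0|n_gt0].
    have card0 (A : {set 'I_n}) : #|A| = k.
      by apply/eqP; rewrite eqn_leq; have := max_card A; rewrite card_ord; lia.
    by rewrite !card0.
  have [c uvc] := best_cut_exists (init_set u k) (init_set v k) n_gt0.
  have := HZ (inord k) c; rewrite kE => /(_ uvc)[<- <-].
  rewrite !card_jumps_full ?flag_dim //; first exact: rev_rank_inj.
  exact: shift_rank_inj.
have [x Ex] := perm_of_chain (fun k kn => (card_Z k kn).1)
  (fun k kn => (nested k kn).1).
have [y Ey] := perm_of_chain (fun k kn => (card_Z k kn).2)
  (fun k kn => (nested k kn).2).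
have xyJ (i : 'I_n.-1) : init_set x i.+1 = J (@shift_rank n) i.+1 (a i) /\
                         init_set y i.+1 = J (@rev_rank n) i.+1 (a i).
  have iE : (inord i.+1 : 'I_n.+1) = i.+1 :> nat.
    by rewrite inordK // ltnS inner_lt.
  have := HZ (inord i.+1) (a i); rewrite iE => /(_ (uv i))[-> ->].
  by rewrite Ex ?Ey ?inner_lt.
exists x, y; split; last by apply/open_tilted_richardson_vecE.
- by rewrite vec_leE; apply/forallP => i; have [-> _] := xyJ i; have [] := HG i.
- rewrite vec_leE; apply/forallP => i; have [-> ->] := xyJ i.
  exact: jumps_best_cut.
by rewrite vec_leE; apply/forallP => i; have [_ ->] := xyJ i; have [] := HG i.
Qed.

End Flags.

(** * The stratification *)

From mathcomp Require Import classical_sets.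
Local Open Scope classical_set_scope.

Theorem theorem5p2 (R : realType) (n : nat) (u v : 'S_n) :
  let D := [set p : 'S_n * 'S_n | tilted_le u p.1 p.2 /\ tilted_le u p.2 v] in
  tilted_richardson R u v
    = \bigcup_(p in D) open_tilted_richardson R p.1 p.2
  /\ trivIset D (fun p => open_tilted_richardson R p.1 p.2).
Proof.
(* Both claims use a single vector a with u <=_a v. *)
move=> D; have DP a p : vec_le a u v ->
    D p <-> [/\ vec_le a u p.1, vec_le a p.1 p.2 & vec_le a p.2 v].
  move=> uv; have E := tilted_interval p.1 p.2 uv.
  by split=> [[xy yv]|/and3P]; [apply/and3P; rewrite -E xy yv
                               | rewrite -E => /andP[]].
split.
  apply/seteqP; split=> G.
    move=> [a uv /(flag_position uv)[x [y [ux xy yv Gxy]]]].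
    by exists (x, y); [apply/(DP a)|exists a].
  have [a uv] := vec_le_exists u v.
  move=> [[x y] /(DP _ _ uv)/=[ux xy yv] [b _ Gb]]; exists a => //.
  have /open_tilted_richardson_vecE Ga :=
    open_tilted_richardson_change_cut xy Gb.
  move: ux yv; rewrite !vec_leE => /forallP ux /forallP yv.
  by apply/tilted_richardson_vecE => i; have [<- <-] := Ga i.
have [a uv] := vec_le_exists u v.
move=> [x y] [x' y'] /(DP _ _ uv)/=[_ xy _] /(DP _ _ uv)/=[_ xy' _].
move=> [G /= [[b _ Gb] [b' _ Gb']]].
have /open_tilted_richardson_vecE Ga :=
  open_tilted_richardson_change_cut xy Gb.
have /open_tilted_richardson_vecE Ga' :=
  open_tilted_richardson_change_cut xy' Gb'.
by congr (_, _); apply: init_set_inj => i;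
   have [Ex Ey] := Ga i; have [Ex' Ey'] := Ga' i; rewrite ?Ex ?Ey.
Qed.
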